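(* The following identity holds: $$\frac1\pi=\sum_{n=0}^{\infty}\frac{\left(\frac13\right)_n\left(\frac12\right)_n\left(\frac23\right)_n}{(1)_n^3}\left(\frac{297\sqrt3-91\sqrt{11}}{64}\,n+\frac{75\sqrt3-33\sqrt{11}}{64}\right)\left(\frac{2457\sqrt{33}-14121}{2048}\right)^n .$$
   Context: The Pochhammer symbol is $(u)_0=1$ and $(u)_n=u(u+1)\cdots(u+n-1)$ for $n\ge1$; $(1)_n^3$ means $((1)_n)^3=(n!)^3$. *)

(* Defs.v *)
From Stdlib Require Import Reals.
Open Scope R_scope.

Fixpoint pochhammer (u : R) (n : nat) : R :=
  match n with
  | O => 1
  | S m => pochhammer u m * (u + INR m)
  end.

(* Main.v *)
Require Import Defs.
From Stdlib Require Import Reals Lra Lia Psatz Factorial.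
From Coquelicot Require Import Coquelicot.
Open Scope R_scope.

(** Write c_a(n) = (a)_n (1/2)_n (1-a)_n / n!^3 and F_a(x) = sum c_a(n) x^n.
    The series of the theorem is a combination of F_{1/3} and its logarithmic
    derivative at a point x0 of Q(sqrt 33).  In modular terms the point is
    tau = (1 + sqrt(-11))/2, where j(tau) = -32768 is rational, so the level-one
    function F_{1/6} is met there at the rational point 1728/j = -27/512.  The proof
    evaluates the level-one series and transports the value to level three.

    Level one.  The identity
      sum c_{1/6}(n) (154 n + 15) (-27/512)^n = 32 sqrt 2 / pi
    ([sextic_series_for_inv_pi]) comes from a Wilf-Zeilberger pair ([wz_pair]):
    the series is the case m = 0 of a family sum_n F(n,m) whose value does not
    depend on m ([wz_F_Series_const]), and in which only the term n = 0
    survives as m goes to infinity ([wz_F_Series_near]).  That term is sixteen times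
    a partial product of prod_j (1 - 1/(16 j^2)), whose limit
    sin(pi/4) / (pi/4) = 2 sqrt 2 / pi is found by Euler's method, from the ratio of
    the integrals of cos(x/2) cos^(2m) x and cos^(2m) x ([sine_prod_lim]).

    From level one to level three.  With u(x) = 4x(1-x) and
    v(x) = 64 x (1-x)^3 / (1+8x)^3 one has Ramanujan's cubic transformation
      F_{1/3}(u(x)) = (1+8x)^(-1/2) F_{1/6}(v(x))
    for small x <= 0 ([cubic_transformation]).  Both sides, with their first
    two logarithmic derivatives, solve the same first-order system with a regular
    singularity at 0 ([gauged_system]).  Its exponents at 0 all vanish, so a solution
    that is regular there is determined by its value at 0
    ([cubic_system_unique]), and the two sides agree at 0.

    Conclusion.  At x = (155 - 27 sqrt 33)/128 one gets v(x) = -27/512 and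
    u(x) = x0 ([modulus11_values]).  The transformation and its derivative then express
    F_{1/3} and its logarithmic derivative at x0 through those of F_{1/6} at -27/512,
    and the coefficients of the theorem are those for which exactly the
    combination 154, 15 appears. *)

(** * A Wilf-Zeilberger pair for the argument -27/512 *)

Definition wz_term (n m : nat) : R :=
  (- 1 / 32) ^ n * (1 / 4) ^ m * pochhammer (1 / 2) (3 * n + 2 * m)
    * pochhammer (1 / 2) n ^ 2
    / (INR (fact n) * INR (fact (2 * n + m)) ^ 2).

Lemma pochhammer_pos (u : R) (n : nat) : 0 < u -> 0 < pochhammer u n.
Proof.
  intros Hu; induction n as [|n IH]; simpl; [lra|].
  apply Rmult_lt_0_compat; [exact IH|]. generalize (pos_INR n); lra.
Qed.

Lemma INR_fact_S (n : nat) : INR (fact (S n)) = (INR n + 1) * INR (fact n).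
Proof. now rewrite fact_simpl, mult_INR, S_INR. Qed.

Lemma wz_term_succ_l (n m : nat) :
  wz_term (S n) m =
  - (wz_term n m
     * ((3 * INR n + 2 * INR m + 1 / 2) * (3 * INR n + 2 * INR m + 3 / 2)
        * (3 * INR n + 2 * INR m + 5 / 2) * (INR n + 1 / 2) ^ 2)
     / (32 * (INR n + 1) * (2 * INR n + INR m + 1) ^ 2 * (2 * INR n + INR m + 2) ^ 2)).
Proof.
  unfold wz_term.
  replace (3 * S n + 2 * m)%nat with (S (S (S (3 * n + 2 * m)))) by lia.
  replace (2 * S n + m)%nat with (S (S (2 * n + m))) by lia.
  cbn [pochhammer]. rewrite !INR_fact_S, !S_INR, !plus_INR, !mult_INR.
  simpl (INR 2); simpl (INR 3). rewrite <- !tech_pow_Rmult.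
  generalize (INR_fact_lt_0 n) (INR_fact_lt_0 (2 * n + m)) (pos_INR n) (pos_INR m).
  intros; field; repeat split; lra.
Qed.

Lemma wz_term_succ_r (n m : nat) :
  wz_term n (S m) =
  wz_term n m * ((3 * INR n + 2 * INR m + 1 / 2) * (3 * INR n + 2 * INR m + 3 / 2))
    / (4 * (2 * INR n + INR m + 1) ^ 2).
Proof.
  unfold wz_term.
  replace (3 * n + 2 * S m)%nat with (S (S (3 * n + 2 * m))) by lia.
  replace (2 * n + S m)%nat with (S (2 * n + m)) by lia.
  cbn [pochhammer]. rewrite !INR_fact_S, !S_INR, !plus_INR, !mult_INR.
  simpl (INR 2); simpl (INR 3). rewrite <- !tech_pow_Rmult.
  generalize (INR_fact_lt_0 n) (INR_fact_lt_0 (2 * n + m)) (pos_INR n) (pos_INR m).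
  intros; field; repeat split; lra.
Qed.

(** Once [wz_G] is chosen, asking for a companion of the form [wz_F] with a cubic
    numerator is a linear system for the coefficients, and this is its
    solution.  It factors in the two
    cases used later: for [m = 0] it is [(154 n + 15) (2 n + 1) ^ 2], and for [n = 0]
    it is [(4 m + 1) (4 m + 3) (4 m + 5)]. *)
Definition wz_poly (n m : R) : R :=
  616 * n ^ 3 + 880 * n ^ 2 * m + 416 * n * m ^ 2 + 64 * m ^ 3
  + 676 * n ^ 2 + 624 * n * m + 144 * m ^ 2 + 214 * n + 92 * m + 15.

Definition wz_F (n m : nat) : R :=
  wz_term n m * wz_poly (INR n) (INR m) / (2 * INR n + INR m + 1) ^ 2.

Definition wz_G (n m : nat) : R := 64 * INR n * wz_term n m.

Lemma wz_pair (n m : nat) :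
  wz_F n (S m) - wz_F n m = wz_G (S n) m - wz_G n m.
Proof.
  unfold wz_F, wz_G, wz_poly. rewrite wz_term_succ_l, wz_term_succ_r, !S_INR.
  generalize (pos_INR n) (pos_INR m); intros.
  field; lra.
Qed.

Lemma wz_term_ratio (n m : nat) :
  Rabs (wz_term (S n) m)
  <= Rabs (wz_term n m) * ((INR n + 1 / 2) ^ 2 / (4 * (INR n + 1) * (2 * INR n + INR m + 2))).
Proof.
  rewrite wz_term_succ_l, Rabs_Ropp.
  generalize (pos_INR n) (pos_INR m); intros Hn Hm.
  set (x := INR n) in *; set (y := INR m) in *.
  unfold Rdiv at 1. rewrite Rmult_assoc, Rabs_mult.
  apply Rmult_le_compat_l; [apply Rabs_pos|].
  rewrite Rabs_pos_eq.
  2: { apply Rmult_le_pos.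
       - repeat apply Rmult_le_pos; try lra; apply pow_le; lra.
       - left; apply Rinv_0_lt_compat; repeat apply Rmult_lt_0_compat; try lra; apply pow_lt; lra. }
  (* Bounding the three linear factors this way cancels one square of the denominator and one factor of the other. *)
  apply Rle_trans with
    ((2 * (2 * x + y + 1)) * (2 * (2 * x + y + 1)) * (2 * (2 * x + y + 2)) * (x + 1 / 2) ^ 2
     * / (32 * (x + 1) * (2 * x + y + 1) ^ 2 * (2 * x + y + 2) ^ 2)).
  - apply Rmult_le_compat_r.
    + left; apply Rinv_0_lt_compat; repeat apply Rmult_lt_0_compat; try lra; apply pow_lt; lra.
    + apply Rmult_le_compat_r; [apply pow_le; lra|].
      repeat (apply Rmult_le_compat; try (repeat apply Rmult_le_pos; lra); try lra).
  - right; field; lra.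
Qed.

(** The ratio of consecutive terms is at most 1/8 uniformly in [m]; this makes every
    passage to the limit below a comparison with a geometric series. *)
Lemma wz_term_geometric (n m : nat) :
  Rabs (wz_term n m) <= Rabs (wz_term 0 m) * (1 / 8) ^ n.
Proof.
  induction n as [|n IH]; [simpl; lra|].
  eapply Rle_trans; [apply wz_term_ratio|].
  simpl pow at 2. rewrite (Rmult_comm (1 / 8)), <- Rmult_assoc.
  generalize (pos_INR n) (pos_INR m); intros Hn Hm.
  apply Rmult_le_compat; [apply Rabs_pos| |exact IH|].
  - apply Rmult_le_pos; [apply pow_le; lra|].
    left; apply Rinv_0_lt_compat; nra.
  - apply Rle_div_l; [nra|]. nra.
Qed.

(** The first ratio also decays like [1/m], so all terms but the first vanish
    as [m] grows. *)
Lemma wz_term_geometric_S (n m : nat) :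
  Rabs (wz_term (S n) m)
  <= Rabs (wz_term 0 m) * / (8 * (INR m + 1)) * (1 / 8) ^ n.
Proof.
  generalize (pos_INR m); intros Hm.
  induction n as [|n IH].
  - eapply Rle_trans; [apply wz_term_ratio|].
    simpl (INR 0); simpl ((1 / 8) ^ 0). rewrite Rmult_1_r.
    apply Rmult_le_compat_l; [apply Rabs_pos|].
    apply Rle_div_l; [lra|].
    apply Rmult_le_reg_l with (8 * (INR m + 1)); [lra|].
    rewrite <- Rmult_assoc, Rinv_r; lra.
  - eapply Rle_trans; [apply wz_term_ratio|].
    simpl pow at 2. rewrite (Rmult_comm (1 / 8)), <- Rmult_assoc.
    generalize (pos_INR (S n)); intros Hn.
    apply Rmult_le_compat; [apply Rabs_pos| |exact IH|].
    + apply Rmult_le_pos; [apply pow_le; lra|].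
      left; apply Rinv_0_lt_compat; nra.
    + apply Rle_div_l; [nra|]. nra.
Qed.

Lemma wz_term_0_bound (m : nat) : Rabs (wz_term 0 m) * (INR m + 1) <= 1.
Proof.
  induction m as [|m IH].
  - unfold wz_term; simpl. rewrite Rabs_pos_eq; lra.
  - rewrite wz_term_succ_r, S_INR.
    unfold Rdiv at 1. rewrite Rmult_assoc, Rabs_mult.
    generalize (pos_INR m); intros Hm. simpl (INR 0).
    set (y := INR m) in *.
    rewrite (Rabs_pos_eq (_ * / _)).
    2: { apply Rmult_le_pos; [nra|]. left; apply Rinv_0_lt_compat; nra. }
    apply Rle_trans with (Rabs (wz_term 0 m) * (y + 1)); [|exact IH].
    rewrite Rmult_assoc. apply Rmult_le_compat_l; [apply Rabs_pos|].
    replace (_ * _) with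
      (((2 * y + 1 / 2) * (2 * y + 3 / 2) * (y + 2)) / (4 * (y + 1) ^ 2)) by (field; lra).
    apply Rle_div_l; [nra|]. nra.
Qed.

Lemma wz_F_le (n m : nat) :
  Rabs (wz_F n m) <= 154 * (2 * INR n + 1) * (INR m + 1) * Rabs (wz_term n m).
Proof.
  unfold wz_F, wz_poly.
  generalize (pos_INR n) (pos_INR m); intros Hn Hm.
  set (x := INR n) in *; set (y := INR m) in *.
  unfold Rdiv at 1. rewrite Rmult_assoc, Rabs_mult, Rmult_comm.
  apply Rmult_le_compat_r; [apply Rabs_pos|].
  rewrite Rabs_pos_eq.
  2: { apply Rmult_le_pos; [|left; apply Rinv_0_lt_compat; nra].
       repeat apply Rplus_le_le_0_compat; repeat apply Rmult_le_pos; try apply pow_le; lra. }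
  apply Rle_div_l; [nra|].
  apply Rle_trans with (154 * (2 * x + y + 1) ^ 3).
  - assert (0 <= x ^ 3 /\ 0 <= x ^ 2 * y /\ 0 <= x * y ^ 2 /\ 0 <= y ^ 3 /\ 0 <= x ^ 2 /\ 0 <= x * y /\ 0 <= y ^ 2).
    { repeat split; repeat apply Rmult_le_pos; try apply pow_le; lra. }
    lra.
  - replace (154 * (2 * x + y + 1) ^ 3) with (154 * (2 * x + y + 1) * (2 * x + y + 1) ^ 2) by ring.
    apply Rmult_le_compat_r; [nra|]. nra.
Qed.

Lemma linear_le_pow2 (n : nat) : 2 * INR n + 1 <= 2 * 2 ^ n.
Proof.
  induction n as [|n IH]; [simpl; lra|].
  rewrite S_INR; simpl. assert (1 <= 2 ^ n) by (apply pow_R1_Rle; lra). lra.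
Qed.

Lemma pow8_split (n : nat) : (1 / 8) ^ n = (1 / 2) ^ n * (1 / 4) ^ n.
Proof. rewrite <- Rpow_mult_distr; f_equal; lra. Qed.

Lemma pow2_half (n : nat) : 2 ^ n * (1 / 2) ^ n = 1.
Proof. rewrite <- Rpow_mult_distr. replace (2 * (1 / 2)) with 1 by lra. apply pow1. Qed.

Lemma linear_pow8_le (n : nat) : (2 * INR n + 1) * (1 / 8) ^ n <= 2 * (1 / 4) ^ n.
Proof.
  rewrite pow8_split, <- Rmult_assoc.
  apply Rmult_le_compat_r; [apply pow_le; lra|].
  apply Rle_trans with (2 * 2 ^ n * (1 / 2) ^ n).
  - apply Rmult_le_compat_r; [apply pow_le; lra| apply linear_le_pow2].
  - rewrite Rmult_assoc, pow2_half; lra.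
Qed.

Lemma wz_F_bound (n m : nat) : Rabs (wz_F n m) <= 308 * (1 / 4) ^ n.
Proof.
  eapply Rle_trans; [apply wz_F_le|].
  generalize (pos_INR n) (pos_INR m) (wz_term_geometric n m) (wz_term_0_bound m)
    (linear_pow8_le n) (Rabs_pos (wz_term 0 m)); intros Hn Hm H1 H2 H3 H4.
  assert (0 < (1 / 8) ^ n) by (apply pow_lt; lra).
  apply Rle_trans with (154 * (2 * INR n + 1) * (INR m + 1) * (Rabs (wz_term 0 m) * (1 / 8) ^ n)).
  { apply Rmult_le_compat_l; [|exact H1]. repeat apply Rmult_le_pos; lra. }
  replace (154 * (2 * INR n + 1) * (INR m + 1) * (Rabs (wz_term 0 m) * (1 / 8) ^ n))
    with (154 * ((2 * INR n + 1) * (1 / 8) ^ n) * (Rabs (wz_term 0 m) * (INR m + 1))) by ring.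
  assert (0 <= (2 * INR n + 1) * (1 / 8) ^ n) by (apply Rmult_le_pos; lra).
  nra.
Qed.

Lemma wz_F_bound_S (n m : nat) : Rabs (wz_F (S n) m) <= 154 / (INR m + 1) * (1 / 4) ^ n.
Proof.
  eapply Rle_trans; [apply wz_F_le|].
  generalize (pos_INR n) (pos_INR m) (wz_term_geometric_S n m) (wz_term_0_bound m)
    (linear_pow8_le n) (Rabs_pos (wz_term 0 m)); intros Hn Hm H1 H2 H3 H4.
  rewrite S_INR.
  assert (0 < (1 / 8) ^ n) by (apply pow_lt; lra).
  assert (Hi : 0 < / (INR m + 1)) by (apply Rinv_0_lt_compat; lra).
  eapply Rle_trans.
  { apply Rmult_le_compat_l; [|exact H1]. repeat apply Rmult_le_pos; lra. }
  replace (_ * _) with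
    (154 * / (INR m + 1) * ((2 * INR n + 3) * (1 / 8) ^ n / 8 * (Rabs (wz_term 0 m) * (INR m + 1))))
    by (field; lra).
  unfold Rdiv at 4. apply Rmult_le_compat_l; [lra|].
  assert ((2 * INR n + 3) * (1 / 8) ^ n / 8 <= (1 / 4) ^ n) by nra.
  assert (0 <= (2 * INR n + 3) * (1 / 8) ^ n / 8).
  { apply Rmult_le_pos; [apply Rmult_le_pos|]; lra. }
  nra.
Qed.

Lemma is_lim_seq_scal_geom (c q : R) : Rabs q < 1 -> is_lim_seq (fun n => c * q ^ n) 0.
Proof.
  intros Hq. evar_last; [apply is_lim_seq_scal_l, is_lim_seq_geom; exact Hq|].
  simpl; f_equal; ring.
Qed.

Lemma ex_series_geom_bound (f : nat -> R) (c q : R) :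
  Rabs q < 1 -> (forall n, Rabs (f n) <= c * q ^ n) -> ex_series f.
Proof.
  intros Hq Hf. apply (@ex_series_le _ R_CompleteNormedModule _ (fun n => c * q ^ n)).
  - intros n; exact (Hf n).
  - apply (ex_series_scal_l c (fun n => q ^ n)). exists (/ (1 - q)). now apply is_series_geom.
Qed.

Lemma wz_F_ex_series (m : nat) : ex_series (fun n => wz_F n m).
Proof.
  apply ex_series_geom_bound with 308 (1 / 4); [rewrite Rabs_pos_eq; lra|].
  intros n; apply wz_F_bound.
Qed.

Lemma wz_G_lim (m : nat) : is_lim_seq (fun n => wz_G n m) 0.
Proof.
  apply is_lim_seq_abs_0.
  apply is_lim_seq_le_le with (u := fun _ => 0) (w := fun n => 64 * (1 / 4) ^ n).
  - intros n; split; [apply Rabs_pos|].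
    unfold wz_G. rewrite Rabs_mult, (Rabs_pos_eq (64 * _)) by (generalize (pos_INR n); lra).
    generalize (pos_INR n) (pos_INR m) (wz_term_geometric n m) (wz_term_0_bound m)
      (linear_pow8_le n) (Rabs_pos (wz_term 0 m)); intros Hn Hm H1 H2 H3 H4.
    assert (0 < (1 / 8) ^ n) by (apply pow_lt; lra).
    assert (Rabs (wz_term 0 m) <= 1) by nra.
    assert (Rabs (wz_term n m) <= (1 / 8) ^ n) by nra.
    assert (INR n * Rabs (wz_term n m) <= INR n * (1 / 8) ^ n) by (apply Rmult_le_compat_l; lra).
    nra.
  - apply is_lim_seq_const.
  - apply is_lim_seq_scal_geom; rewrite Rabs_pos_eq; lra.
Qed.

(** By [wz_pair] the difference of two consecutive sums telescopes to the limit of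
    [wz_G] minus [wz_G 0 m], and the latter vanishes thanks to the factor [n]. *)
Lemma wz_F_Series_const (m : nat) :
  Series (fun n => wz_F n m) = Series (fun n => wz_F n 0).
Proof.
  induction m as [|m IH]; [reflexivity|]. rewrite <- IH.
  apply Rminus_diag_uniq. rewrite <- Series_minus by apply wz_F_ex_series.
  apply is_series_unique.
  change (is_lim_seq (sum_n (fun n => wz_F n (S m) - wz_F n m)) 0).
  apply is_lim_seq_ext with (fun n => wz_G (S n) m).
  - intros n; induction n as [|n IHn].
    + rewrite sum_O, wz_pair. unfold wz_G at 3; simpl (INR 0); ring.
    + rewrite sum_Sn, <- IHn, wz_pair. unfold plus; simpl; ring.
  - apply (is_lim_seq_incr_1 (fun n => wz_G n m)), wz_G_lim.
Qed.

Lemma wz_F_Series_near (m : nat) :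
  Rabs (Series (fun n => wz_F n 0) - wz_F 0 m) <= 308 / (INR m + 1).
Proof.
  generalize (pos_INR m); intros Hm.
  rewrite <- (wz_F_Series_const m), Series_incr_1 by apply wz_F_ex_series.
  replace (_ - _) with (Series (fun n => wz_F (S n) m)) by ring.
  assert (Hg : is_series (fun n => 154 / (INR m + 1) * (1 / 4) ^ n) (154 / (INR m + 1) * / (1 - 1 / 4))).
  { apply (is_series_scal_l (154 / (INR m + 1)) (fun n => (1 / 4) ^ n)).
    apply is_series_geom; rewrite Rabs_pos_eq; lra. }
  assert (Ha : ex_series (fun n => Rabs (wz_F (S n) m))).
  { apply ex_series_geom_bound with (154 / (INR m + 1)) (1 / 4); [rewrite Rabs_pos_eq; lra|].
    intros n; rewrite Rabs_Rabsolu; apply wz_F_bound_S. }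
  eapply Rle_trans; [apply Series_Rabs; exact Ha|].
  eapply Rle_trans.
  { apply Series_le with (b := fun n => 154 / (INR m + 1) * (1 / 4) ^ n); [|now eexists; exact Hg].
    intros n; split; [apply Rabs_pos | apply wz_F_bound_S]. }
  rewrite (is_series_unique _ _ Hg).
  apply Rmult_le_reg_r with (INR m + 1); [lra|].
  replace (308 / (INR m + 1) * (INR m + 1)) with 308 by (field; lra).
  replace (154 / (INR m + 1) * / (1 - 1 / 4) * (INR m + 1)) with (154 * (4 / 3)) by (field; lra).
  lra.
Qed.

(** * The partial products of sin(pi/4)/(pi/4) *)

Fixpoint sine_prod (m : nat) : R :=
  match m with
  | O => 1
  | S k => sine_prod k * (1 - 1 / (16 * (INR k + 1) ^ 2))
  end.

Lemma wz_term_0_sine_prod (m : nat) : wz_term 0 m * (4 * INR m + 1) = sine_prod m.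
Proof.
  induction m as [|m IH].
  - unfold wz_term; simpl; field.
  - simpl sine_prod. rewrite <- IH, wz_term_succ_r, S_INR. simpl (INR 0).
    generalize (pos_INR m); intros; field; lra.
Qed.

Lemma wz_F_0_sine_prod (m : nat) : wz_F 0 m = 16 * sine_prod (S m).
Proof.
  simpl sine_prod. rewrite <- wz_term_0_sine_prod. unfold wz_F, wz_poly. simpl (INR 0).
  generalize (pos_INR m); intros; field; lra.
Qed.

(** All sums over [n] being equal, they equal the limit of the terms [n = 0]. *)
Lemma wz_F_Series_lim (l : R) :
  is_lim_seq sine_prod l -> is_series (fun n => wz_F n 0) (16 * l).
Proof.
  intros Hl.
  assert (H1 : is_lim_seq (fun m => wz_F 0 m) (16 * l)).
  { apply is_lim_seq_ext with (fun m => 16 * sine_prod (S m)).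
    - intros m; now rewrite wz_F_0_sine_prod.
    - apply (is_lim_seq_scal_l (fun m => sine_prod (S m)) 16 l).
      now apply (is_lim_seq_incr_1 sine_prod). }
  assert (H2 : is_lim_seq (fun m => wz_F 0 m) (Series (fun n => wz_F n 0))).
  { apply is_lim_seq_ext with
      (fun m => Series (fun n => wz_F n 0) - (Series (fun n => wz_F n 0) - wz_F 0 m)).
    { intros m; ring. }
    evar_last.
    - apply is_lim_seq_minus'; [apply is_lim_seq_const|].
      apply is_lim_seq_abs_0.
      apply is_lim_seq_le_le with (u := fun _ => 0) (w := fun m => 308 / (INR m + 1)).
      + intros m; split; [apply Rabs_pos | apply wz_F_Series_near].
      + apply is_lim_seq_const.
      + evar_last.
        * apply is_lim_seq_scal_l with (lu := 0).
          apply is_lim_seq_ext with (fun m => / INR (S m)).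
          { intros m; now rewrite S_INR. }
          apply (is_lim_seq_incr_1 (fun m => / INR m)).
          evar_last; [apply is_lim_seq_inv; [apply is_lim_seq_INR | discriminate]| reflexivity].
        * simpl; f_equal; ring.
    - simpl; f_equal; ring. }
  assert (E : Series (fun n => wz_F n 0) = 16 * l).
  { apply is_lim_seq_unique in H1, H2. rewrite H1 in H2. now injection H2. }
  rewrite <- E. apply Series_correct, wz_F_ex_series.
Qed.

Definition cos_int (z : R) (n : nat) : R :=
  RInt (fun x => cos (z * x) * cos x ^ n) 0 (PI / 2).

Lemma cos_int_ex (z : R) (n : nat) :
  ex_RInt (fun x => cos (z * x) * cos x ^ n) 0 (PI / 2).
Proof.
  apply (@ex_RInt_continuous R_CompleteNormedModule).
  intros x _. apply (@ex_derive_continuous R_AbsRing R_NormedModule). auto_derive; trivial.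
Qed.

(** Integration by parts twice, in the form of an explicit antiderivative; for
    [z = 0] it is Wallis's recursion. *)
Lemma cos_int_rec (z : R) (n : nat) :
  ((INR n + 2) ^ 2 - z ^ 2) * cos_int z (S (S n))
  = (INR n + 2) * (INR n + 1) * cos_int z n.
Proof.
  apply Rminus_diag_uniq. unfold cos_int.
  rewrite <- !(@RInt_scal R_CompleteNormedModule) by apply cos_int_ex.
  rewrite <- (@RInt_minus R_CompleteNormedModule);
    try (apply (@ex_RInt_scal R_NormedModule); apply cos_int_ex).
  set (W := fun x => (INR n + 2) * cos (z * x) * cos x ^ S n * sin x
                     - z * sin (z * x) * cos x ^ S (S n)).
  apply (@is_RInt_unique R_CompleteNormedModule).
  evar_last; [apply (@is_RInt_derive R_CompleteNormedModule W)|].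
  - intros x _. unfold W. auto_derive; [trivial|].
    unfold minus, plus, opp, scal; simpl; unfold mult; simpl.
    change (Init.Nat.pred (S n)) with n.
    replace (match n with O => 1 | S _ => INR n + 1 end) with (INR n + 1)
      by (destruct n; simpl; ring).
    assert (E : sin x * sin x = 1 - cos x * cos x).
    { generalize (sin2_cos2 x); unfold Rsqr; lra. }
    match goal with |- ?L = ?R => apply Rminus_diag_uniq;
      replace (L - R) with ((sin x * sin x - (1 - cos x * cos x))
        * (- (INR n + 2) * (INR n + 1) * cos (z * x) * cos x ^ n)) by ring end.
    rewrite E; ring.
  - intros x _. apply (@ex_derive_continuous R_AbsRing R_NormedModule).
    unfold minus, plus, opp, scal; simpl; unfold mult; simpl. auto_derive; trivial.
  - unfold W, minus, plus, opp; simpl. rewrite cos_PI2, (Rmult_0_r z), sin_0; ring.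
Qed.

Lemma cos_int_0_pos (n : nat) : 0 < cos_int 0 n.
Proof.
  apply RInt_gt_0.
  - generalize PI_RGT_0; lra.
  - intros x Hx. rewrite Rmult_0_l, cos_0, Rmult_1_l.
    apply pow_lt, cos_gt_0; generalize PI_RGT_0; lra.
  - intros x _. apply (@ex_derive_continuous R_AbsRing R_NormedModule). auto_derive; trivial.
Qed.

(** On the interval of integration [cos x ^ 2 <= cos (x / 2) <= 1], so the integral
    with [z = 1/2] lies between two consecutive Wallis integrals, whose ratio tends
    to 1. *)
Lemma cos_half_int_bounds (n : nat) :
  cos_int 0 (S (S n)) <= cos_int (1 / 2) n <= cos_int 0 n.
Proof.
  split; apply RInt_le; try apply cos_int_ex; try (generalize PI_RGT_0; lra);
    intros x Hx; rewrite Rmult_0_l, cos_0, Rmult_1_l.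
  - assert (0 < cos x) by (apply cos_gt_0; generalize PI_RGT_0; lra).
    assert (cos x <= cos (1 / 2 * x)) by (apply cos_decr_1; generalize PI_RGT_0; lra).
    assert (0 < cos x ^ n) by (apply pow_lt; lra). generalize (COS_bound x); intros.
    simpl. rewrite <- Rmult_assoc. apply Rmult_le_compat_r; nra.
  - assert (0 <= cos x) by (apply cos_ge_0; generalize PI_RGT_0; lra).
    generalize (COS_bound (1 / 2 * x)) (pow_le _ n H); intros. nra.
Qed.

Lemma cos_int_half_0 : cos_int (1 / 2) 0 = sqrt 2.
Proof.
  apply (@is_RInt_unique R_CompleteNormedModule).
  evar_last; [apply (@is_RInt_derive R_CompleteNormedModule (fun x => 2 * sin (1 / 2 * x)))|].
  - intros x _. auto_derive; [trivial|]. simpl; field.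
  - intros x _. apply (@ex_derive_continuous R_AbsRing R_NormedModule). auto_derive; trivial.
  - unfold minus, plus, opp; simpl. replace (1 / 2 * (PI / 2)) with (PI / 4) by field.
    rewrite Rmult_0_r, sin_0, sin_PI4.
    assert (H := Rlt_sqrt2_0). apply Rmult_eq_reg_r with (sqrt 2); [|lra].
    rewrite sqrt_sqrt by lra. field. lra.
Qed.

Lemma cos_int_0_0 : cos_int 0 0 = PI / 2.
Proof.
  unfold cos_int. rewrite (RInt_ext _ (fun _ => 1)).
  - rewrite RInt_const. unfold scal; simpl; unfold mult; simpl. ring.
  - intros x _. rewrite Rmult_0_l, cos_0; simpl; ring.
Qed.

(** Dividing the recursion for [z = 1/2] by that for [z = 0] produces exactly one
    factor [1 - 1 / (16 j ^ 2)] per step, which is why the product is a quotient of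
    the two integrals. *)
Lemma sine_prod_cos_int (m : nat) :
  sine_prod m * cos_int (1 / 2) (2 * m) * PI = 2 * sqrt 2 * cos_int 0 (2 * m).
Proof.
  induction m as [|m IH].
  - simpl (2 * 0)%nat. rewrite cos_int_half_0, cos_int_0_0; simpl; field.
  - replace (2 * S m)%nat with (S (S (2 * m))) by lia. cbn [sine_prod].
    generalize (cos_int_rec (1 / 2) (2 * m)) (cos_int_rec 0 (2 * m)) (pos_INR m).
    rewrite mult_INR. simpl (INR 2). intros H1 H2 Hm.
    assert (E0 : cos_int 0 (S (S (2 * m))) = (2 * INR m + 1) / (2 * INR m + 2) * cos_int 0 (2 * m)).
    { apply Rmult_eq_reg_l with ((2 * INR m + 2) ^ 2); [|nra].
      transitivity (((1 + 1) * INR m + 2) * ((1 + 1) * INR m + 1) * cos_int 0 (2 * m));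
        [rewrite <- H2; ring | field; lra]. }
    assert (E1 : (1 - 1 / (16 * (INR m + 1) ^ 2)) * cos_int (1 / 2) (S (S (2 * m)))
                 = (2 * INR m + 1) / (2 * INR m + 2) * cos_int (1 / 2) (2 * m)).
    { apply Rmult_eq_reg_l with ((2 * INR m + 2) ^ 2); [|nra].
      transitivity (((1 + 1) * INR m + 2) * ((1 + 1) * INR m + 1) * cos_int (1 / 2) (2 * m));
        [rewrite <- H1; field; lra | field; lra]. }
    rewrite E0.
    transitivity ((2 * INR m + 1) / (2 * INR m + 2)
                  * (sine_prod m * cos_int (1 / 2) (2 * m) * PI)).
    + rewrite (Rmult_assoc (sine_prod m) _ (cos_int _ (S _))), E1; ring.
    + rewrite IH; ring.
Qed.

Lemma sine_prod_lim : is_lim_seq sine_prod (2 * sqrt 2 / PI).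
Proof.
  assert (Hpi := PI_RGT_0). assert (H2 := Rlt_sqrt2_0).
  assert (Hb : forall m, 2 * sqrt 2 / PI <= sine_prod m
             <= 2 * sqrt 2 / PI * (1 + / (INR (2 * m) + 1))).
  { intros m. generalize (sine_prod_cos_int m) (cos_half_int_bounds (2 * m))
      (cos_int_0_pos (S (S (2 * m)))) (cos_int_rec 0 (2 * m)) (pos_INR (2 * m)).
    set (a := cos_int (1 / 2) (2 * m)). set (b := cos_int 0 (2 * m)).
    set (b' := cos_int 0 (S (S (2 * m)))). set (x := INR (2 * m)).
    intros E [Hl Hu] Hp Hr Hx.
    assert (Ha : 0 < a) by lra.
    assert (Es : sine_prod m = 2 * sqrt 2 / PI * (b / a)).
    { apply Rmult_eq_reg_r with (a * PI); [|nra].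
      rewrite <- Rmult_assoc, E. field; lra. }
    rewrite Es.
    assert (Hc : 0 < 2 * sqrt 2 / PI) by (apply Rdiv_lt_0_compat; lra).
    assert (Hr' : b = (1 + / (x + 1)) * b').
    { apply Rmult_eq_reg_l with ((x + 2) * (x + 1)); [|nra].
      rewrite <- Hr. field; lra. }
    split.
    - rewrite <- (Rmult_1_r (2 * sqrt 2 / PI)) at 1. apply Rmult_le_compat_l; [lra|].
      apply Rle_div_r; lra.
    - apply Rmult_le_compat_l; [lra|]. apply Rle_div_l; [lra|]. rewrite Hr'.
      assert (0 < / (x + 1)) by (apply Rinv_0_lt_compat; lra).
      apply Rmult_le_compat_l; lra. }
  apply is_lim_seq_le_le with (1 := Hb); [apply is_lim_seq_const|].
  evar_last.
  - apply is_lim_seq_scal_l.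
    apply is_lim_seq_plus'; [apply is_lim_seq_const|].
    apply is_lim_seq_le_le with (u := fun _ => 0) (w := fun m => / INR (S m)).
    + intros m. generalize (pos_INR m); intros. rewrite mult_INR; simpl (INR 2); rewrite S_INR. split.
      * left; apply Rinv_0_lt_compat; lra.
      * apply Rinv_le_contravar; lra.
    + apply is_lim_seq_const.
    + apply (is_lim_seq_incr_1 (fun m => / INR m)).
      evar_last; [apply is_lim_seq_inv; [apply is_lim_seq_INR | discriminate]| reflexivity].
  - simpl; f_equal; ring.
Qed.

(** * The hypergeometric series and their differential equation *)

Definition clausen_coef (a : R) (n : nat) : R :=
  pochhammer a n * pochhammer (1 / 2) n * pochhammer (1 - a) n / pochhammer 1 n ^ 3.

Lemma clausen_coef_0 (a : R) : clausen_coef a 0 = 1.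
Proof. unfold clausen_coef; simpl; field. Qed.

Lemma clausen_coef_S (a : R) (n : nat) :
  clausen_coef a (S n) =
  clausen_coef a n * ((INR n + a) * (INR n + 1 / 2) * (INR n + (1 - a)) / (INR n + 1) ^ 3).
Proof.
  unfold clausen_coef; cbn [pochhammer].
  generalize (pochhammer_pos 1 n ltac:(lra)) (pos_INR n); intros.
  field; split; lra.
Qed.

Lemma wz_term_clausen_coef (n : nat) :
  wz_term n 0 = clausen_coef (1 / 6) n * (-27 / 512) ^ n.
Proof.
  induction n as [|n IH].
  - rewrite clausen_coef_0. unfold wz_term; simpl; field.
  - rewrite wz_term_succ_l, IH, clausen_coef_S. simpl (INR 0). rewrite <- (tech_pow_Rmult _ n).
    generalize (pos_INR n); intros; field; lra.
Qed.

Lemma wz_F_0_r (n : nat) :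
  wz_F n 0 = clausen_coef (1 / 6) n * (154 * INR n + 15) * (-27 / 512) ^ n.
Proof.
  unfold wz_F, wz_poly. rewrite wz_term_clausen_coef. simpl (INR 0).
  generalize (pos_INR n); intros; field; lra.
Qed.

(** The row [m = 0] of the pair is this series, because [(1/2)_{3n}] is
    [27 ^ n (1/6)_n (1/2)_n (5/6)_n] and [(2n)!] is [4 ^ n n! (1/2)_n]. *)
Lemma sextic_series_for_inv_pi :
  is_series (fun n => clausen_coef (1 / 6) n * (154 * INR n + 15) * (-27 / 512) ^ n)
    (32 * sqrt 2 / PI).
Proof.
  apply is_series_ext with (fun n => wz_F n 0).
  - exact wz_F_0_r.
  - replace (32 * sqrt 2 / PI) with (16 * (2 * sqrt 2 / PI)) by (field; apply PI_neq0).
    apply wz_F_Series_lim, sine_prod_lim.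
Qed.

Lemma clausen_coef_bounds (a : R) (n : nat) : 0 < a < 1 -> 0 < clausen_coef a n <= 1.
Proof.
  intros Ha; induction n as [|n IH]; [rewrite clausen_coef_0; lra|].
  rewrite clausen_coef_S. generalize (pos_INR n); intros Hn. set (x := INR n) in *.
  assert (H3 : 0 < (x + 1) ^ 3) by (apply pow_lt; lra).
  assert (Hr : 0 < (x + a) * (x + 1 / 2) * (x + (1 - a)) / (x + 1) ^ 3 <= 1).
  { split.
    - apply Rdiv_lt_0_compat; [|exact H3]. repeat apply Rmult_lt_0_compat; lra.
    - apply Rle_div_l; [exact H3|]. rewrite Rmult_1_l.
      replace ((x + 1) ^ 3) with ((x + 1) * (x + 1) * (x + 1)) by ring.
      repeat (apply Rmult_le_compat; try (repeat apply Rmult_le_pos; lra); try lra). }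
  nra.
Qed.

(** The Euler operator [x d/dx] on coefficient sequences. *)
Definition theta (c : nat -> R) (n : nat) : R := INR n * c n.

Lemma theta_incr (c : nat -> R) (n : nat) : theta c n = PS_incr_1 (PS_derive c) n.
Proof.
  destruct n; unfold theta, PS_incr_1, PS_derive; [|reflexivity].
  unfold zero; simpl; ring.
Qed.

Lemma CV_radius_theta (c : nat -> R) : CV_radius (theta c) = CV_radius c.
Proof.
  rewrite (CV_radius_ext _ (PS_incr_1 (PS_derive c))) by apply theta_incr.
  now rewrite CV_radius_incr_1, CV_radius_derive.
Qed.

Lemma PSeries_theta (c : nat -> R) (x : R) :
  PSeries (theta c) x = x * PSeries (PS_derive c) x.
Proof.
  rewrite (PSeries_ext _ (PS_incr_1 (PS_derive c))) by apply theta_incr.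
  apply PSeries_incr_1.
Qed.

Lemma is_derive_PSeries_theta (c : nat -> R) (x : R) :
  Rbar_lt (Rabs x) (CV_radius c) -> x <> 0 ->
  is_derive (PSeries c) x (PSeries (theta c) x / x).
Proof.
  intros Hx Hx0. evar_last; [now apply is_derive_PSeries|].
  rewrite PSeries_theta. field; exact Hx0.
Qed.

Lemma CV_radius_clausen_coef (a x : R) :
  0 < a < 1 -> Rabs x < 1 -> Rbar_lt (Rabs x) (CV_radius (clausen_coef a)).
Proof.
  intros Ha Hx. apply Rbar_lt_le_trans with 1; [exact Hx|].
  apply (proj1 (CV_radius_bounded (clausen_coef a))).
  exists 1. intros n. rewrite pow1, Rmult_1_r.
  generalize (clausen_coef_bounds a n Ha); intros. rewrite Rabs_pos_eq; lra.
Qed.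

(** The recurrence of the coefficients says that the Euler operator [t] satisfies
    [t ^ 3 f = x (t + a) (t + 1/2) (t + 1 - a) f]; the equation is stated with the
    third-order terms collected on the left. *)
Lemma clausen_ode (a x : R) :
  0 < a < 1 -> Rabs x < 1 ->
  let c := clausen_coef a in
  PSeries (theta (theta (theta c))) x * (1 - x) =
  x * (3 / 2 * PSeries (theta (theta c)) x + (1 / 2 + a * (1 - a)) * PSeries (theta c) x
       + a * (1 - a) / 2 * PSeries c x).
Proof.
  intros Ha Hx c.
  assert (Hr := CV_radius_clausen_coef a x Ha Hx). fold c in Hr.
  assert (E0 := CV_radius_inside _ _ Hr).
  assert (E1 : ex_pseries (theta c) x) by (apply CV_radius_inside; now rewrite CV_radius_theta).
  assert (E2 : ex_pseries (theta (theta c)) x)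
    by (apply CV_radius_inside; now rewrite !CV_radius_theta).
  assert (E3 : ex_pseries (theta (theta (theta c))) x)
    by (apply CV_radius_inside; now rewrite !CV_radius_theta).
  set (d2 := PS_plus (PS_scal (1 / 2 + a * (1 - a)) (theta c)) (PS_scal (a * (1 - a) / 2) c)).
  set (d1 := PS_plus (PS_scal (3 / 2) (theta (theta c))) d2).
  assert (F0 : ex_pseries (PS_scal (a * (1 - a) / 2) c) x)
    by (apply ex_pseries_scal; [apply Rmult_comm | exact E0]).
  assert (F1 : ex_pseries (PS_scal (1 / 2 + a * (1 - a)) (theta c)) x)
    by (apply ex_pseries_scal; [apply Rmult_comm | exact E1]).
  assert (F2 : ex_pseries (PS_scal (3 / 2) (theta (theta c))) x)
    by (apply ex_pseries_scal; [apply Rmult_comm | exact E2]).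
  assert (G2 : ex_pseries d2 x) by (now apply ex_pseries_plus).
  assert (G1 : ex_pseries d1 x) by (now apply ex_pseries_plus).
  assert (Hd : PSeries (PS_plus (theta (theta (theta c))) d1) x
    = PSeries (theta (theta (theta c))) x
      + (3 / 2 * PSeries (theta (theta c)) x
         + ((1 / 2 + a * (1 - a)) * PSeries (theta c) x + a * (1 - a) / 2 * PSeries c x))).
  { rewrite PSeries_plus by assumption.
    unfold d1; rewrite PSeries_plus by assumption.
    unfold d2; rewrite PSeries_plus by assumption.
    now rewrite !PSeries_scal. }
  assert (Hs : PSeries (theta (theta (theta c))) x
               = x * PSeries (PS_plus (theta (theta (theta c))) d1) x).
  { rewrite <- PSeries_incr_1. apply PSeries_ext. intros [|n].
    - unfold theta, PS_incr_1, zero; simpl; ring.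
    - change (PS_incr_1 (PS_plus (theta (theta (theta c))) d1) (S n))
        with (INR n * (INR n * (INR n * c n)) + (3 / 2 * (INR n * (INR n * c n))
              + ((1 / 2 + a * (1 - a)) * (INR n * c n) + a * (1 - a) / 2 * c n))).
      unfold theta. rewrite S_INR. unfold c. rewrite clausen_coef_S.
      generalize (pos_INR n); intros. field; lra. }
  rewrite Hd in Hs. lra.
Qed.

(** * Uniqueness for a system with a regular singular point *)

Lemma Rabs_le_linear_of_derive (f df : R -> R) (r M a : R) :
  - r <= a <= 0 ->
  (forall x, - r < x < 0 -> is_derive f x (df x)) ->
  (forall x, - r <= x <= 0 -> continuity_pt f x) ->
  (forall x, - r <= x <= 0 -> Rabs (df x) <= M) ->
  f 0 = 0 -> Rabs (f a) <= M * Rabs a.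
Proof.
  intros Ha Hd Hc HM H0.
  destruct (MVT_gen f a 0 df) as [c [Hc1 Hc2]];
    rewrite ?Rmin_left, ?Rmax_right in * by lra.
  - intros x Hx; apply Hd; lra.
  - intros x Hx; apply Hc; lra.
  - replace (f a) with (- (df c * (0 - a))) by lra.
    rewrite Rabs_Ropp, Rabs_mult. replace (0 - a) with (- a) by ring. rewrite Rabs_Ropp.
    apply Rmult_le_compat_r; [apply Rabs_pos | apply HM; lra].
Qed.

Lemma geometric_le_0 (z C : R) : (forall n, Rabs z <= C * (1 / 2) ^ n) -> z = 0.
Proof.
  intros H. apply Rabs_eq_0, Rle_antisym; [|apply Rabs_pos].
  apply (is_lim_seq_le (fun _ => Rabs z) (fun n => C * (1 / 2) ^ n) (Rabs z) 0); auto.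
  - apply is_lim_seq_const.
  - apply is_lim_seq_scal_geom. rewrite Rabs_pos_eq; lra.
Qed.

(** The quotients [D1 / x] and [D2 / x] make the system singular at 0, so Gronwall's
    lemma does not apply directly.  However a bound [|D2| <= K |x|] passes
    through the two singular equations to [|D1| <= 2 K |x|] and [|D0| <= 4 K |x|],
    and the third equation, which is regular, then gives [|D2| <= (K / 2) |x|] on this
    short interval.  Iterating, all three vanish.  A first [K] exists because
    continuous functions are bounded on the interval. *)
Lemma cubic_system_unique (D0 D1 D2 : R -> R) :
  (forall x, -1 / 1000 <= x <= 0 ->
     continuity_pt D0 x /\ continuity_pt D1 x /\ continuity_pt D2 x) ->
  (forall x, -1 / 1000 < x < 0 ->
     is_derive D0 x ((1 - 2 * x) / (1 - x) / x * D1 x) /\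
     is_derive D1 x ((1 - 2 * x) / (1 - x) / x * D2 x) /\
     is_derive D2 x (4 / (1 - 2 * x) * (3 / 2 * D2 x + 13 / 18 * D1 x + 1 / 9 * D0 x))) ->
  D0 0 = 0 -> D1 0 = 0 -> D2 0 = 0 ->
  forall x, -1 / 1000 <= x <= 0 -> D0 x = 0 /\ D1 x = 0.
Proof.
  intros Hc Hd I0 I1 I2.
  assert (Hq : forall x, -1 / 1000 <= x <= 0 -> 0 <= 4 / (1 - 2 * x) <= 4).
  { intros x Hx; split; [left; apply Rdiv_lt_0_compat; lra | apply Rle_div_l; lra]. }
  assert (Hs : forall D K, D 0 = 0 -> 0 <= K ->
            (forall x, -1 / 1000 <= x <= 0 -> Rabs (D x) <= K * Rabs x) ->
            forall x, -1 / 1000 <= x <= 0 -> Rabs ((1 - 2 * x) / (1 - x) / x * D x) <= 2 * K).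
  { intros D K HD HK HDK x Hx. destruct (Req_dec x 0) as [->|Hx0].
    - rewrite HD, Rmult_0_r, Rabs_R0; lra.
    - rewrite Rabs_mult. unfold Rdiv. rewrite Rabs_mult, Rabs_inv.
      assert (0 < Rabs x) by now apply Rabs_pos_lt.
      apply Rle_trans with (2 * / Rabs x * (K * Rabs x)); [|right; field; lra].
      assert (0 < / Rabs x) by now apply Rinv_0_lt_compat.
      apply Rmult_le_compat; auto using Rabs_pos.
      + apply Rmult_le_pos; [apply Rabs_pos | lra].
      + apply Rmult_le_compat_r; [lra|].
        rewrite Rabs_pos_eq by (apply Rdiv_le_0_compat; lra).
        apply Rle_div_l; lra. }
  assert (Hm : forall B0 B1 B2 x, -1 / 1000 <= x <= 0 ->
            Rabs (D0 x) <= B0 -> Rabs (D1 x) <= B1 -> Rabs (D2 x) <= B2 ->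
            Rabs (4 / (1 - 2 * x) * (3 / 2 * D2 x + 13 / 18 * D1 x + 1 / 9 * D0 x))
            <= 6 * (B0 + B1 + B2)).
  { intros B0 B1 B2 x Hx H0 H1 H2. rewrite Rabs_mult, (Rabs_pos_eq (4 / _)) by now apply Hq.
    apply Rle_trans with (4 * (3 / 2 * (B0 + B1 + B2))); [|lra].
    apply Rmult_le_compat; [apply Hq; lra | apply Rabs_pos | apply Hq; lra|].
    apply Rabs_le_between in H0, H1, H2. apply Rabs_le_between. lra. }
  assert (Hb : exists B, 0 <= B /\ forall x, -1 / 1000 <= x <= 0 -> Rabs (D0 x) + Rabs (D1 x) + Rabs (D2 x) <= B).
  { destruct (continuity_ab_maj (fun x => Rabs (D0 x) + Rabs (D1 x) + Rabs (D2 x)) (-1 / 1000) 0)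
      as [M [HM _]]; [lra| |].
    - intros x Hx. destruct (Hc x Hx) as (C0 & C1 & C2).
      repeat apply continuity_pt_plus; apply (continuity_pt_comp _ Rabs); auto;
        apply Rcontinuity_abs.
    - eexists; split; [|exact HM]. generalize (Rabs_pos (D0 M)) (Rabs_pos (D1 M)) (Rabs_pos (D2 M)); lra. }
  destruct Hb as [B [HB0 HB]].
  assert (Hn : forall n x, -1 / 1000 <= x <= 0 ->
            Rabs (D2 x) <= 6 * B * (1 / 2) ^ n * Rabs x /\
            Rabs (D1 x) <= 2 * (6 * B * (1 / 2) ^ n) * Rabs x /\
            Rabs (D0 x) <= 2 * (2 * (6 * B * (1 / 2) ^ n)) * Rabs x).
  { assert (Hstep : forall K, 0 <= K ->
       (forall x, -1 / 1000 <= x <= 0 -> Rabs (D2 x) <= K * Rabs x) ->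
       forall x, -1 / 1000 <= x <= 0 -> Rabs (D1 x) <= 2 * K * Rabs x /\ Rabs (D0 x) <= 2 * (2 * K) * Rabs x).
    { intros K HK H2.
      assert (H1 : forall x, -1 / 1000 <= x <= 0 -> Rabs (D1 x) <= 2 * K * Rabs x).
      { intros x Hx. apply Rabs_le_linear_of_derive with (r := 1 / 1000)
          (df := fun x => (1 - 2 * x) / (1 - x) / x * D2 x); auto; try lra.
        - intros y Hy; apply Hd; lra.
        - intros y Hy; apply Hc; lra.
        - intros y Hy; apply Hs; auto; lra. }
      intros x Hx; split; [now apply H1|].
      apply Rabs_le_linear_of_derive with (r := 1 / 1000)
          (df := fun x => (1 - 2 * x) / (1 - x) / x * D1 x); auto; try lra.
      - intros y Hy; apply Hd; lra.
      - intros y Hy; apply Hc; lra.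
      - intros y Hy; apply Hs; auto; lra. }
    assert (Hstep2 : forall M,
       (forall x, -1 / 1000 <= x <= 0 ->
          Rabs (4 / (1 - 2 * x) * (3 / 2 * D2 x + 13 / 18 * D1 x + 1 / 9 * D0 x)) <= M) ->
       forall x, -1 / 1000 <= x <= 0 -> Rabs (D2 x) <= M * Rabs x).
    { intros M HM x Hx. apply Rabs_le_linear_of_derive with (r := 1 / 1000)
          (df := fun x => 4 / (1 - 2 * x) * (3 / 2 * D2 x + 13 / 18 * D1 x + 1 / 9 * D0 x)); auto; try lra.
      - intros y Hy; apply Hd; lra.
      - intros y Hy; apply Hc; lra.
      - intros y Hy; apply HM; lra. }
    induction n as [|n IH].
    - assert (H2 : forall x, -1 / 1000 <= x <= 0 -> Rabs (D2 x) <= 6 * B * (1 / 2) ^ 0 * Rabs x).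
      { intros x Hx. apply Hstep2; [|exact Hx]. intros y Hy.
        eapply Rle_trans; [apply Hm; auto; apply Rle_refl|].
        specialize (HB y Hy). simpl; lra. }
      intros x Hx; split; [now apply H2|]. apply Hstep; auto. simpl; lra.
    - set (K := 6 * B * (1 / 2) ^ n) in *.
      assert (HK : 0 <= K).
      { unfold K. apply Rmult_le_pos; [lra | apply pow_le; lra]. }
      replace (6 * B * (1 / 2) ^ S n) with (K / 2) by (unfold K; simpl; field).
      assert (H2 : forall x, -1 / 1000 <= x <= 0 -> Rabs (D2 x) <= K / 2 * Rabs x).
      { intros x Hx. apply Hstep2; [|exact Hx]. intros y Hy.
        destruct (IH y Hy) as (J2 & J1 & J0).
        eapply Rle_trans; [apply (Hm _ _ _ y Hy J0 J1 J2)|].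
        assert (Rabs y <= 1 / 1000) by (apply Rabs_le_between; lra).
        assert (K * Rabs y <= K * (1 / 1000)) by (apply Rmult_le_compat_l; lra).
        lra. }
      intros x Hx; split; [now apply H2|]. apply Hstep; auto. lra. }
  intros x Hx; split; apply geometric_le_0 with (24 * B); intros n;
    destruct (Hn n x Hx) as (H2 & H1 & H0);
    assert (0 <= B * (1 / 2) ^ n) by (apply Rmult_le_pos; [lra | apply pow_le; lra]);
    assert (Rabs x <= 1) by (apply Rabs_le_between; lra); nra.
Qed.

(** * The cubic transformation *)

(** Let [t] be the Euler operator, [Q0], [Q1], [Q2] the series [F_{1/6}] at [v(x)] with
    its logarithmic derivatives, [A = (1 + 8 x) ^ (-1/2)], and let [r] be the
    logarithmic derivative of [u(x)] multiplied by [x].  Starting from [A Q0] and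
    applying [t / r] twice gives two combinations of [A Q0], [A Q1], [A Q2]; the
    four functions below are their coefficients.  The coefficient of [A Q2] in the
    second one is [gauge11 ^ 2].  The last fractions in [gauge20] and [gauge21] are the
    derivatives of [gauge10] and [gauge11]. *)
Definition gauge10 (x : R) : R := - 4 * x * (1 - x) / ((1 - 2 * x) * (1 + 8 * x)).
Definition gauge11 (x : R) : R := (1 - 20 * x - 8 * x ^ 2) / ((1 - 2 * x) * (1 + 8 * x)).
Definition gauge20 (x : R) : R :=
  gauge10 x ^ 2
  - x * (1 - x) / (1 - 2 * x) * (4 * (1 - 2 * x + 10 * x ^ 2) / ((1 - 2 * x) * (1 + 8 * x)) ^ 2).
Definition gauge21 (x : R) : R :=
  2 * gauge10 x * gauge11 x
  + x * (1 - x) / (1 - 2 * x) * ((- 26 + 16 * x - 368 * x ^ 2) / ((1 - 2 * x) * (1 + 8 * x)) ^ 2).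

Definition gauged0 (A Q0 : R -> R) (x : R) : R := A x * Q0 x.
Definition gauged1 (A Q0 Q1 : R -> R) (x : R) : R := A x * (gauge11 x * Q1 x + gauge10 x * Q0 x).
Definition gauged2 (A Q0 Q1 Q2 : R -> R) (x : R) : R :=
  A x * (gauge11 x ^ 2 * Q2 x + gauge21 x * Q1 x + gauge20 x * Q0 x).

(** The transported functions satisfy the system of [F_{1/3}] at [u(x)].  The last of
    the three equations is where the choice of [u], [v] and [A] matters: it is
    the coincidence of the two third-order equations, and amounts to an
    identity between rational functions.  Stating it for arbitrary functions that
    satisfy the differential equations keeps the power series out of the algebra. *)
Lemma gauged_system (A Q0 Q1 Q2 : R -> R) (x : R) :
  -1 / 1000 < x < 0 ->
  is_derive A x (- 4 / (1 + 8 * x) * A x) ->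
  (let s := (1 - 20 * x - 8 * x ^ 2) / ((1 - x) * (1 + 8 * x)) in
   is_derive Q0 x (s / x * Q1 x) /\
   is_derive Q1 x (s / x * Q2 x) /\
   is_derive Q2 x (64 * (1 - x) ^ 2 / ((1 - 20 * x - 8 * x ^ 2) * (1 + 8 * x))
                   * (3 / 2 * Q2 x + 23 / 36 * Q1 x + 5 / 72 * Q0 x))) ->
  is_derive (gauged0 A Q0) x ((1 - 2 * x) / (1 - x) / x * gauged1 A Q0 Q1 x) /\
  is_derive (gauged1 A Q0 Q1) x ((1 - 2 * x) / (1 - x) / x * gauged2 A Q0 Q1 Q2 x) /\
  is_derive (gauged2 A Q0 Q1 Q2) x
    (4 / (1 - 2 * x) * (3 / 2 * gauged2 A Q0 Q1 Q2 x + 13 / 18 * gauged1 A Q0 Q1 x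
                        + 1 / 9 * gauged0 A Q0 x)).
Proof.
  intros Hx HA HQ; cbv zeta in HQ; destruct HQ as (H0 & H1 & H2).
  assert (E : ex_derive A x /\ ex_derive Q0 x /\ ex_derive Q1 x /\ ex_derive Q2 x)
    by (refine (conj _ (conj _ (conj _ _))); eexists; eassumption).
  destruct E as (EA & E0 & E1 & E2).
  apply is_derive_unique in HA, H0, H1, H2.
  assert (x <> 0 /\ 1 - x <> 0 /\ 1 - 2 * x <> 0 /\ 1 + 8 * x <> 0 /\ 1 - 20 * x - 8 * x ^ 2 <> 0)
    by (repeat split; nra).
  unfold gauged0, gauged1, gauged2, gauge20, gauge21, gauge10, gauge11.
  refine (conj _ (conj _ _)); auto_derive;
    try (repeat apply conj; (assumption || exact I || (simpl; repeat apply Rmult_integral_contrapositive_currified; lra)));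
    change (Derive (fun x => A x) x) with (Derive A x);
    change (Derive (fun x => Q0 x) x) with (Derive Q0 x);
    change (Derive (fun x => Q1 x) x) with (Derive Q1 x);
    change (Derive (fun x => Q2 x) x) with (Derive Q2 x).
  - rewrite HA, H0. field; intuition.
  - rewrite HA, H0, H1. field; intuition.
  - rewrite HA, H0, H1, H2. field; intuition.
Qed.

(** The series with coefficients [clausen_coef a], to which the Euler operator has been
    applied [k] times. *)
Definition clausen (a : R) (k : nat) : R -> R := PSeries (Nat.iter k theta (clausen_coef a)).

Lemma clausen_in_radius (a x : R) (k : nat) :
  0 < a < 1 -> Rabs x < 1 ->
  Rbar_lt (Rabs x) (CV_radius (Nat.iter k theta (clausen_coef a))).
Proof.
  intros Ha Hx; induction k as [|k IH]; [now apply CV_radius_clausen_coef|].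
  simpl Nat.iter. now rewrite CV_radius_theta.
Qed.

Lemma clausen_at_0 (a : R) (k : nat) : clausen a k 0 = match k with O => 1 | S _ => 0 end.
Proof.
  unfold clausen. rewrite PSeries_0. destruct k; [apply clausen_coef_0|].
  simpl Nat.iter. unfold theta at 1. simpl (INR 0). ring.
Qed.

Lemma clausen_comp_continuity (a : R) (k : nat) (f : R -> R) (x : R) :
  0 < a < 1 -> Rabs (f x) < 1 -> ex_derive f x ->
  continuity_pt (fun t => clausen a k (f t)) x.
Proof.
  intros Ha Hx Hf. apply (continuity_pt_comp f (clausen a k)).
  - apply continuity_pt_filterlim, (@ex_derive_continuous R_AbsRing R_NormedModule), Hf.
  - apply PSeries_continuity, clausen_in_radius; assumption.
Qed.

Lemma clausen_comp_derive (a : R) (k : nat) (f : R -> R) (x l : R) :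
  0 < a < 1 -> Rabs (f x) < 1 -> f x <> 0 -> is_derive f x (l * f x) ->
  is_derive (fun t => clausen a k (f t)) x (l * clausen a (S k) (f x)).
Proof.
  intros Ha Hx H0 Hf. evar_last.
  - apply (is_derive_comp (clausen a k) f); [|exact Hf].
    apply is_derive_PSeries_theta; [now apply clausen_in_radius | exact H0].
  - unfold scal; simpl; unfold mult; simpl. unfold clausen; simpl Nat.iter. field; exact H0.
Qed.

Lemma clausen_3 (a x : R) :
  0 < a < 1 -> Rabs x < 1 ->
  clausen a 3 x =
  x / (1 - x) * (3 / 2 * clausen a 2 x + (1 / 2 + a * (1 - a)) * clausen a 1 x
                 + a * (1 - a) / 2 * clausen a 0 x).
Proof.
  intros Ha Hx. assert (H := clausen_ode a x Ha Hx).
  apply Rabs_def2 in Hx. unfold clausen; simpl Nat.iter.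
  apply Rmult_eq_reg_r with (1 - x); [|lra]. rewrite H. field; lra.
Qed.

(** With [x = c ^ 3 / a ^ 3] in the notation of the cubic theta functions,
    [sextic_arg x] is [1728 / j]. *)
Definition cubic_arg (x : R) : R := 4 * x * (1 - x).
Definition sextic_arg (x : R) : R := 64 * x * (1 - x) ^ 3 / (1 + 8 * x) ^ 3.

Lemma cubic_arg_bounds (x : R) :
  -1 / 1000 <= x <= 0 -> Rabs (cubic_arg x) < 1.
Proof. intros Hx; unfold cubic_arg; apply Rabs_def1; nra. Qed.

Lemma sextic_arg_bounds (x : R) :
  -1 / 1000 <= x <= 0 -> Rabs (sextic_arg x) < 1.
Proof.
  intros Hx; unfold sextic_arg.
  assert (H1 : 1 <= (1 - x) ^ 3 <= 2).
  { split; [apply pow_R1_Rle; lra|]. apply Rle_trans with ((1001 / 1000) ^ 3); [|lra].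
    apply pow_incr; lra. }
  assert (H2 : 1 / 2 <= (1 + 8 * x) ^ 3).
  { apply Rle_trans with ((992 / 1000) ^ 3); [lra|]. apply pow_incr; lra. }
  unfold Rdiv. rewrite Rabs_mult, Rabs_inv, (Rabs_pos_eq ((1 + 8 * x) ^ 3)) by lra.
  apply Rlt_div_l; [lra|].
  apply Rabs_def1; nra.
Qed.

(** The second equation is the first one differentiated; both come out
    of the uniqueness statement, applied to the differences of the two sides. *)
Lemma cubic_transformation (x : R) :
  -1 / 1000 <= x <= 0 ->
  clausen (1 / 3) 0 (cubic_arg x) = / sqrt (1 + 8 * x) * clausen (1 / 6) 0 (sextic_arg x) /\
  clausen (1 / 3) 1 (cubic_arg x) =
    / sqrt (1 + 8 * x) * (gauge11 x * clausen (1 / 6) 1 (sextic_arg x)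
                          + gauge10 x * clausen (1 / 6) 0 (sextic_arg x)).
Proof.
  set (A := fun x => / sqrt (1 + 8 * x)).
  set (P := fun k x => clausen (1 / 3) k (cubic_arg x)).
  set (Q := fun k x => clausen (1 / 6) k (sextic_arg x)).
  assert (Ez : cubic_arg 0 = 0 /\ sextic_arg 0 = 0) by (unfold cubic_arg, sextic_arg; split; field).
  destruct Ez as [Ec Es].
  assert (Hder : forall x, -1 / 1000 <= x <= 0 -> ex_derive cubic_arg x /\ ex_derive sextic_arg x /\ ex_derive A x /\
     ex_derive gauge10 x /\ ex_derive gauge11 x /\ ex_derive gauge20 x /\ ex_derive gauge21 x).
  { intros t Ht. unfold cubic_arg, sextic_arg, A, gauge20, gauge21, gauge10, gauge11.
    assert (0 < sqrt (1 + 8 * t)) by (apply sqrt_lt_R0; lra).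
    refine (conj _ (conj _ (conj _ (conj _ (conj _ (conj _ _))))));
      auto_derive; repeat apply conj; (exact I || lra ||
        (simpl; repeat apply Rmult_integral_contrapositive_currified; lra)). }
  assert (Hcont : forall f x, ex_derive f x -> continuity_pt f x).
  { intros f t Hf. apply continuity_pt_filterlim, (@ex_derive_continuous R_AbsRing R_NormedModule), Hf. }
  assert (Hsys : forall t, -1 / 1000 <= t <= 0 ->
    P 0%nat t - gauged0 A (Q 0%nat) t = 0 /\ P 1%nat t - gauged1 A (Q 0%nat) (Q 1%nat) t = 0).
  { apply (cubic_system_unique _ _
      (fun t => P 2%nat t - gauged2 A (Q 0%nat) (Q 1%nat) (Q 2%nat) t)).
    - intros t Ht. destruct (Hder t Ht) as (d1 & d2 & d3 & d4 & d5 & d6 & d7).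
      assert (CQ : forall k, continuity_pt (Q k) t).
      { intros k; apply clausen_comp_continuity; [lra | now apply sextic_arg_bounds | exact d2]. }
      assert (CP : forall k, continuity_pt (P k) t).
      { intros k; apply clausen_comp_continuity; [lra | now apply cubic_arg_bounds | exact d1]. }
      assert (C11 : continuity_pt (fun t => gauge11 t ^ 2) t).
      { apply Hcont. now apply (ex_derive_pow gauge11 2). }
      apply Hcont in d3, d4, d5, d6, d7.
      unfold gauged0, gauged1, gauged2.
      refine (conj _ (conj _ _)); (apply continuity_pt_minus; [apply CP|]);
        repeat first [exact C11 | assumption | apply CQ
                     | apply continuity_pt_mult | apply continuity_pt_plus].
    - intros t Ht. assert (Ht' : -1 / 1000 <= t <= 0) by lra.
      assert (Hn : 0 < 1 - 20 * t - 8 * t ^ 2) by nra.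
      assert (HA : is_derive A t (- 4 / (1 + 8 * t) * A t)).
      { unfold A. assert (0 < sqrt (1 + 8 * t)) by (apply sqrt_lt_R0; lra).
        auto_derive; [split; [lra|split; [lra|exact I]]|].
        assert (Hq := sqrt_sqrt (1 + 8 * t) ltac:(lra)).
        rewrite <- Hq at 4. field. lra. }
      assert (DQ : forall k, is_derive (Q k) t
         ((1 - 20 * t - 8 * t ^ 2) / ((1 - t) * (1 + 8 * t)) / t * Q (S k) t)).
      { intros k. apply clausen_comp_derive; [lra | now apply sextic_arg_bounds | |].
        - unfold sextic_arg. apply Rmult_integral_contrapositive_currified.
          + apply Rmult_integral_contrapositive_currified; [lra | apply pow_nonzero; lra].
          + apply Rinv_neq_0_compat, pow_nonzero; lra.
        - unfold sextic_arg. auto_derive.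
          + simpl; repeat apply Rmult_integral_contrapositive_currified; lra.
          + simpl; field; lra. }
      assert (DP : forall k, is_derive (P k) t ((1 - 2 * t) / (1 - t) / t * P (S k) t)).
      { intros k. apply clausen_comp_derive; [lra | now apply cubic_arg_bounds | |].
        - unfold cubic_arg. nra.
        - unfold cubic_arg. auto_derive; [exact I|]. field; lra. }
      destruct (gauged_system A (Q 0%nat) (Q 1%nat) (Q 2%nat) t Ht HA) as (G0 & G1 & G2).
      { cbv zeta. refine (conj (DQ 0%nat) (conj (DQ 1%nat) _)). evar_last; [apply DQ|].
        unfold Q at 1. rewrite clausen_3 by (lra || now apply sextic_arg_bounds).
        fold (Q 0%nat t) (Q 1%nat t) (Q 2%nat t).
        replace (1 - sextic_arg t) with ((1 - 20 * t - 8 * t ^ 2) ^ 2 / (1 + 8 * t) ^ 3)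
          by (unfold sextic_arg; field; lra).
        unfold sextic_arg. field; lra. }
      assert (G3 : is_derive (P 2%nat) t
         (4 / (1 - 2 * t) * (3 / 2 * P 2%nat t + 13 / 18 * P 1%nat t + 1 / 9 * P 0%nat t))).
      { evar_last; [apply DP|].
        unfold P at 1. rewrite clausen_3 by (lra || now apply cubic_arg_bounds).
        fold (P 0%nat t) (P 1%nat t) (P 2%nat t).
        replace (1 - cubic_arg t) with ((1 - 2 * t) ^ 2) by (unfold cubic_arg; ring).
        unfold cubic_arg. field; lra. }
      refine (conj _ (conj _ _));
        (evar_last; [apply @is_derive_minus; [first [exact G3 | apply DP] | eassumption]|]);
        unfold minus, plus, opp; simpl; ring.
    - unfold gauged0, P, Q, A. rewrite Ec, Es, !clausen_at_0, Rmult_0_r, Rplus_0_r, sqrt_1; field.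
    - unfold gauged1, P, Q, A, gauge10. rewrite Ec, Es, !clausen_at_0, Rmult_0_r, Rplus_0_r, sqrt_1; field.
    - unfold gauged2, P, Q, A, gauge20, gauge10. rewrite Ec, Es, !clausen_at_0, !Rmult_0_r, Rplus_0_r, sqrt_1; field. }
  intros Hx. destruct (Hsys x Hx) as [S0 S1].
  split; apply Rminus_diag_uniq; [exact S0 | exact S1].
Qed.

(** * Evaluation at the point of discriminant -11 *)

Lemma clausen_01_is_series (a x A B : R) :
  0 < a < 1 -> Rabs x < 1 ->
  is_series (fun n => clausen_coef a n * (A * INR n + B) * x ^ n)
    (A * clausen a 1 x + B * clausen a 0 x).
Proof.
  intros Ha Hx.
  assert (Hs : forall k, is_series (fun n => Nat.iter k theta (clausen_coef a) n * x ^ n) (clausen a k x)).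
  { intros k. apply (is_pseries_R (Nat.iter k theta (clausen_coef a)) x).
    apply PSeries_correct, CV_radius_inside, clausen_in_radius; assumption. }
  eapply is_series_ext; [|apply (is_series_plus _ _ _ _ (is_series_scal_l A _ _ (Hs 1%nat))
                             (is_series_scal_l B _ _ (Hs 0%nat)))].
  intros n.
  change (A * (INR n * clausen_coef a n * x ^ n) + B * (clausen_coef a n * x ^ n)
          = clausen_coef a n * (A * INR n + B) * x ^ n).
  ring.
Qed.

(** The root near 0 of [sextic_arg x = -27 / 512]. *)
Definition modulus11 : R := (155 - 27 * sqrt 33) / 128.

Lemma sqrt_33_bounds : 5744 / 1000 < sqrt 33 < 5745 / 1000.
Proof.
  assert (H := sqrt_sqrt 33 ltac:(lra)). assert (H0 := sqrt_pos 33). split; nra.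
Qed.

Lemma modulus11_bounds : -1 / 1000 <= modulus11 <= 0.
Proof. unfold modulus11. assert (H := sqrt_33_bounds). lra. Qed.

Lemma modulus11_values :
  cubic_arg modulus11 = (2457 * sqrt 33 - 14121) / 2048 /\
  sextic_arg modulus11 = -27 / 512 /\
  gauge11 modulus11 = 21 * (209 - 3 * sqrt 33) / 3944 /\
  gauge10 modulus11 = (123 * sqrt 33 - 681) / 7888.
Proof.
  assert (Hx := modulus11_bounds).
  assert (E2 := sqrt_sqrt 33 ltac:(lra)).
  unfold modulus11 in *. set (s := sqrt 33) in *.
  assert (E3 : s ^ 3 = 33 * s) by (rewrite <- E2; ring).
  assert (E4 : s ^ 4 = 33 * 33) by (rewrite <- E2; ring).
  unfold cubic_arg, sextic_arg, gauge11, gauge10.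
  set (x := (155 - 27 * s) / 128) in *.
  refine (conj _ (conj _ (conj _ _))).
  - unfold x; lra.
  - apply Rmult_eq_reg_r with ((1 + 8 * x) ^ 3); [|apply pow_nonzero; lra].
    transitivity (64 * x * (1 - x) ^ 3); [field; lra|]. unfold x; lra.
  - apply Rmult_eq_reg_r with ((1 - 2 * x) * (1 + 8 * x)); [|nra].
    transitivity (1 - 20 * x - 8 * x ^ 2); [field; lra|]. unfold x; lra.
  - apply Rmult_eq_reg_r with ((1 - 2 * x) * (1 + 8 * x)); [|nra].
    transitivity (- 4 * x * (1 - x)); [field; lra|]. unfold x; lra.
Qed.

(** Denesting the radical is what brings [sqrt 3], [sqrt 11] and [sqrt 2] separately
    into the final coefficients: [19 - 3 sqrt 33] is half the square of
    [3 sqrt 3 - sqrt 11]. *)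
Lemma sqrt_modulus11 :
  sqrt (1 + 8 * modulus11) = 3 * (3 * sqrt 3 - sqrt 11) / (4 * sqrt 2).
Proof.
  assert (E33 : sqrt 33 = sqrt 3 * sqrt 11).
  { rewrite <- sqrt_mult by lra. f_equal; lra. }
  assert (E3 := sqrt_sqrt 3 ltac:(lra)). assert (E11 := sqrt_sqrt 11 ltac:(lra)).
  assert (E2 := sqrt_sqrt 2 ltac:(lra)).
  assert (P2 := Rlt_sqrt2_0). assert (P3 := sqrt_pos 3). assert (P11 := sqrt_pos 11).
  assert (Hp : 0 < 3 * sqrt 3 - sqrt 11) by nra.
  apply sqrt_lem_1.
  - assert (H := modulus11_bounds); lra.
  - apply Rdiv_le_0_compat; lra.
  - unfold modulus11. rewrite E33.
    replace (3 * (3 * sqrt 3 - sqrt 11) / (4 * sqrt 2) * (3 * (3 * sqrt 3 - sqrt 11) / (4 * sqrt 2)))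
      with (9 * (9 * (sqrt 3 * sqrt 3) - 6 * (sqrt 3 * sqrt 11) + sqrt 11 * sqrt 11)
            / (16 * (sqrt 2 * sqrt 2))) by (field; lra).
    rewrite E2, E3, E11. field.
Qed.

Theorem theorem3p4 :
  is_series
    (fun n : nat =>
       pochhammer (1 / 3) n * pochhammer (1 / 2) n * pochhammer (2 / 3) n
         / (pochhammer 1 n) ^ 3
       * ((297 * sqrt 3 - 91 * sqrt 11) / 64 * INR n
          + (75 * sqrt 3 - 33 * sqrt 11) / 64)
       * ((2457 * sqrt 33 - 14121) / 2048) ^ n)
    (1 / PI).
Proof.
  assert (Hm := modulus11_bounds).
  destruct modulus11_values as (Vc & Vs & V11 & V10).
  destruct (cubic_transformation modulus11 Hm) as [T0 T1].
  assert (Hc := cubic_arg_bounds modulus11 Hm).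
  assert (Hs := sextic_arg_bounds modulus11 Hm).
  rewrite Vs in T0, T1, Hs. rewrite Vc in T0, T1, Hc.
  rewrite V11, V10 in T1. rewrite sqrt_modulus11 in T0, T1.
  assert (Hsextic : 154 * clausen (1 / 6) 1 (-27 / 512) + 15 * clausen (1 / 6) 0 (-27 / 512)
                    = 32 * sqrt 2 / PI).
  { rewrite <- (is_series_unique _ _ sextic_series_for_inv_pi).
    symmetry; apply is_series_unique, clausen_01_is_series; lra. }
  replace (2 / 3) with (1 - 1 / 3) by field.
  evar_last; [apply (clausen_01_is_series (1 / 3)); lra|].
  rewrite T0, T1.
  assert (E33 : sqrt 33 = sqrt 3 * sqrt 11).
  { rewrite <- sqrt_mult by lra. f_equal; lra. }
  rewrite E33.
  assert (P2 := Rlt_sqrt2_0). assert (E2 := sqrt_sqrt 2 ltac:(lra)).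
  assert (E3 := sqrt_sqrt 3 ltac:(lra)). assert (E11 := sqrt_sqrt 11 ltac:(lra)).
  assert (P3 := sqrt_pos 3). assert (P11 := sqrt_pos 11).
  assert (Hp : 0 < 3 * sqrt 3 - sqrt 11) by nra.
  set (q0 := clausen (1 / 6) 0 _) in *. set (q1 := clausen (1 / 6) 1 _) in *.
  set (a := sqrt 3) in *. set (b := sqrt 11) in *.
  assert (Ea : a * a * b = 3 * b) by now rewrite E3.
  assert (Eb : a * (b * b) = a * 11) by now rewrite E11.
  (* With [C1] and [C0] the combination is proportional to [154 q1 + 15 q0]. *)
  assert (C1 : (297 * a - 91 * b) / 64 * (21 * (209 - 3 * (a * b)) / 3944)
               = 154 * 3 / 256 * (3 * a - b)) by lra.
  assert (C0 : (297 * a - 91 * b) / 64 * ((123 * (a * b) - 681) / 7888) + (75 * a - 33 * b) / 64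
               = 15 * 3 / 256 * (3 * a - b)) by lra.
  transitivity (4 * sqrt 2 / (3 * (3 * a - b))
    * (((297 * a - 91 * b) / 64 * (21 * (209 - 3 * (a * b)) / 3944)) * q1
       + ((297 * a - 91 * b) / 64 * ((123 * (a * b) - 681) / 7888) + (75 * a - 33 * b) / 64) * q0)).
  { field; lra. }
  rewrite C1, C0.
  transitivity (sqrt 2 / 64 * (154 * q1 + 15 * q0)); [field; lra|].
  rewrite Hsextic.
  transitivity (sqrt 2 * sqrt 2 / (2 * PI)); [field; apply PI_neq0|].
  rewrite E2. field; apply PI_neq0.
Qed.
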